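(* Let $\mathbb F$ be a field, $n\ge 2$, $\mathfrak q=(q_{ij})$ a multiplicatively antisymmetric $n\times n$ matrix over $\mathbb F^\ast$, and let $\mathcal O_{\mathfrak q}((\mathbb F^\ast)^n)$ be the corresponding quantum torus. Suppose that the subgroup $\Lambda=\langle q_{ij}\rangle$ of $\mathbb F^\ast$ is torsion-free. Put $N=\binom n2$, choose a basis $p_1,\dots,p_l$ of the free abelian group $\Lambda$, and let $\mathsf M\in \mathrm{Mat}_{N\times l}(\mathbb Z)$ be the matrix of exponents of the commutators $\lambda(\mathbf e_i,\mathbf e_j)$ $(i<j)$ with respect to this basis (see context). Then $$\mathrm{Aut}(\mathbb Z^n,\lambda)=\bigl(\mathrm{Stab}_{\mathrm{GL}(n,\mathbb Z)}(\mathsf M)\bigr)^t=\{A^t \mid A\in \mathrm{GL}(n,\mathbb Z),\ (\wedge^2A)\,\mathsf M=\mathsf M\},$$ where $t$ denotes transposition and $\mathrm{Stab}_{\mathrm{GL}(n,\mathbb Z)}(\mathsf M)=\{A\in \mathrm{GL}(n,\mathbb Z)\mid (\wedge^2 A)\mathsf M=\mathsf M\}$ is the stabilizer of $\mathsf M$ with respect to the bivector representation $\mathrm{GL}(n,\mathbb Z)\to \mathrm{GL}(N,\mathbb Z)$, $A\mapsto \wedge^2A$, and the action of $\mathrm{GL}(N,\mathbb Z)$ on $\mathrm{Mat}_{N\times l}(\mathbb Z)$ by left multiplication.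
   Context: Multiplicatively antisymmetric means $q_{ii}=1$ and $q_{ji}=q_{ij}^{-1}$ for all $i,j$. The quantum torus $\mathcal O_{\mathfrak q}((\mathbb F^\ast)^n)$ is the $\mathbb F$-algebra generated by $X_1^{\pm1},\dots,X_n^{\pm1}$ subject to $X_iX_j=q_{ij}X_jX_i$. For $\mathbf m\in\mathbb Z^n$ put $\mathbf X^{\mathbf m}=X_1^{m_1}\cdots X_n^{m_n}$ (a unit). The map $\lambda:\mathbb Z^n\times\mathbb Z^n\to\mathbb F^\ast$, $\lambda(\mathbf m,\mathbf m')=\mathbf X^{\mathbf m}\mathbf X^{\mathbf m'}(\mathbf X^{\mathbf m})^{-1}(\mathbf X^{\mathbf m'})^{-1}$, is an alternating $\mathbb Z$-bilinear map with values in $\Lambda$; in particular $\lambda(\mathbf e_i,\mathbf e_j)=q_{ij}$ for the standard basis vectors. $\mathrm{Aut}(\mathbb Z^n,\lambda)$ is the group of all $\sigma\in\mathrm{GL}(n,\mathbb Z)$ (acting on column vectors) with $\lambda(\sigma\mathbf m,\sigma\mathbf m')=\lambda(\mathbf m,\mathbf m')$ for all $\mathbf m,\mathbf m'\in\mathbb Z^n$. Write $\lambda(\mathbf e_i,\mathbf e_j)=p_1^{m_1^{(ij)}}\cdots p_l^{m_l^{(ij)}}$ for $1\le i<j\le n$, with integers $m_s^{(ij)}$. Order the $N=\binom n2$ pairs $(ij)$, $i<j$, lexicographically. The matrix $\mathsf M$ has $((ij),s)$ entry $m_s^{(ij)}$. For $A\in\mathrm{GL}(n,\mathbb Z)$,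 $\wedge^2A$ is the $N\times N$ matrix with rows and columns indexed by the pairs $(ij)$, $i<j$, in lexicographic order, whose $((ij),(kl))$ entry is the $2\times2$ minor of $A$ on rows $i,j$ and columns $k,l$. *)

(* Defs.v *)
From HB Require Import structures.
From mathcomp Require Import all_boot all_order all_algebra.
From mathcomp Require Import boolp classical_sets.

Set Implicit Arguments.
Unset Strict Implicit.
Unset Printing Implicit Defensive.

Import GRing.Theory.
Local Open Scope quotient_scope.
Local Open Scope classical_set_scope.
Local Open Scope ring_scope.

Definition mul_antisym (F : fieldType) (n : nat) (q : 'M[F]_n) : Prop :=
  [/\ forall i j, q i j != 0,
      forall i, q i i = 1 &
      forall i j, q j i = (q i j)^-1].

(* The quantum torus is the algebra presented by the generators X_i, X_i^-1   *)
(* and the relations X_i X_i^-1 = X_i^-1 X_i = 1 and X_i X_j = q_ij X_j X_i:  *)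
(* formal noncommutative expressions are divided by the smallest congruence   *)
(* [qeq] containing the axioms of F-algebras and these relations.             *)
Inductive qexpr (F : Type) (n : nat) : Type :=
| QX of 'I_n
| QXV of 'I_n
| QC of F
| QAdd of qexpr F n & qexpr F n
| QMul of qexpr F n & qexpr F n.

Arguments QX {F n}.
Arguments QXV {F n}.
Arguments QC {F n}.

HB.instance Definition _ (F : Type) (n : nat) := gen_eqMixin (qexpr F n).
HB.instance Definition _ (F : Type) (n : nat) := gen_choiceMixin (qexpr F n).

Section QuantumTorus.
Variables (F : fieldType) (n : nat) (q : 'M[F]_n).
Local Notation E := (qexpr F n).

Inductive qeq : E -> E -> Prop :=
| qeq_refl x : qeq x x
| qeq_sym x y : qeq x y -> qeq y x
| qeq_trans y x z : qeq x y -> qeq y z -> qeq x z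
| qeq_add x x' y y' : qeq x x' -> qeq y y' -> qeq (QAdd x y) (QAdd x' y')
| qeq_mul x x' y y' : qeq x x' -> qeq y y' -> qeq (QMul x y) (QMul x' y')
| qeq_addA x y z : qeq (QAdd x (QAdd y z)) (QAdd (QAdd x y) z)
| qeq_addC x y : qeq (QAdd x y) (QAdd y x)
| qeq_add0 x : qeq (QAdd (QC 0) x) x
| qeq_addN x : qeq (QAdd (QMul (QC (-1)) x) x) (QC 0)
| qeq_mulA x y z : qeq (QMul x (QMul y z)) (QMul (QMul x y) z)
| qeq_mul1 x : qeq (QMul (QC 1) x) x
| qeq_mulDl x y z : qeq (QMul (QAdd x y) z) (QAdd (QMul x z) (QMul y z))
| qeq_mulDr x y z : qeq (QMul x (QAdd y z)) (QAdd (QMul x y) (QMul x z))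
| qeq_CD a b : qeq (QC (a + b)) (QAdd (QC a) (QC b))
| qeq_CM a b : qeq (QC (a * b)) (QMul (QC a) (QC b))
| qeq_Ccomm a x : qeq (QMul (QC a) x) (QMul x (QC a))
| qeq_XV i : qeq (QMul (QX i) (QXV i)) (QC 1)
| qeq_VX i : qeq (QMul (QXV i) (QX i)) (QC 1)
| qeq_XX i j :
    qeq (QMul (QX i) (QX j)) (QMul (QC (q i j)) (QMul (QX j) (QX i))).

Definition qeqb (x y : E) : bool := `[< qeq x y >].

Fact qeqb_refl : reflexive qeqb.
Proof. by move=> x; apply/asboolP; apply: qeq_refl. Qed.

Fact qeqb_sym : symmetric qeqb.
Proof. by move=> x y; apply/asboolP/asboolP; apply: qeq_sym. Qed.

Fact qeqb_trans : transitive qeqb.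
Proof.
move=> y x z /asboolP xy /asboolP yz; apply/asboolP; exact: qeq_trans yz.
Qed.

Canonical qeqb_equiv := EquivRel qeqb qeqb_refl qeqb_sym qeqb_trans.

(* Multiplicative antisymmetry is only used to prove that the algebra is not  *)
(* trivial, as the nzRing structures require.                                 *)
Definition qtorus (hq : mul_antisym q) : Type := {eq_quot qeqb}.

Hypothesis hq : mul_antisym q.
Local Notation T := (qtorus hq).

HB.instance Definition _ := Choice.on T.
HB.instance Definition _ := EqQuotient.on T.

Let cls (x : E) : T := \pi_T x.

Let clsP x y : cls x = cls y <-> qeq x y.
Proof.
by split=> [/eqP|xy]; [rewrite piE => /asboolP|apply/eqP; rewrite piE; apply/asboolP].
Qed.

Let reprP x : qeq (repr (cls x)) x.
Proof. by apply/clsP; rewrite /cls reprK. Qed.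

Let qadd (x y : T) : T := cls (QAdd (repr x) (repr y)).
Let qmul (x y : T) : T := cls (QMul (repr x) (repr y)).
Let qscalar (c : F) : T := cls (QC c).
Let qopp (x : T) : T := qmul (qscalar (-1)) x.

Let qaddE x y : qadd (cls x) (cls y) = cls (QAdd x y).
Proof. by apply/clsP; apply: qeq_add; apply: reprP. Qed.

Let qmulE x y : qmul (cls x) (cls y) = cls (QMul x y).
Proof. by apply/clsP; apply: qeq_mul; apply: reprP. Qed.

Let clsW (P : T -> Prop) : (forall x, P (cls x)) -> forall x, P x.
Proof. by move=> h x; rewrite -[x]reprK; apply: h. Qed.

Fact qaddA : associative qadd.
Proof.
elim/clsW=> x; elim/clsW=> y; elim/clsW=> z.
by rewrite !qaddE; apply/clsP; apply: qeq_addA.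
Qed.

Fact qaddC : commutative qadd.
Proof.
by elim/clsW=> x; elim/clsW=> y; rewrite !qaddE; apply/clsP; apply: qeq_addC.
Qed.

Fact qadd0 : left_id (qscalar 0) qadd.
Proof. by elim/clsW=> x; rewrite qaddE; apply/clsP; apply: qeq_add0. Qed.

Fact qaddN : left_inverse (qscalar 0) qopp qadd.
Proof.
by elim/clsW=> x; rewrite /qopp qmulE qaddE; apply/clsP; apply: qeq_addN.
Qed.

HB.instance Definition _ := GRing.isZmodule.Build T qaddA qaddC qadd0 qaddN.

Fact qmulA : associative qmul.
Proof.
elim/clsW=> x; elim/clsW=> y; elim/clsW=> z.
by rewrite !qmulE; apply/clsP; apply: qeq_mulA.
Qed.

Fact qscalarC c x : qmul (qscalar c) x = qmul x (qscalar c).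
Proof. by elim/clsW: x => x; rewrite !qmulE; apply/clsP/qeq_Ccomm. Qed.

Fact qmul1 : left_id (qscalar 1) qmul.
Proof. by elim/clsW=> x; rewrite qmulE; apply/clsP; apply: qeq_mul1. Qed.

Fact qmulr1 : right_id (qscalar 1) qmul.
Proof. by move=> x; rewrite -qscalarC qmul1. Qed.

Fact qmulDl : left_distributive qmul qadd.
Proof.
elim/clsW=> x; elim/clsW=> y; elim/clsW=> z.
by rewrite !(qmulE, qaddE); apply/clsP; apply: qeq_mulDl.
Qed.

Fact qmulDr : right_distributive qmul qadd.
Proof.
elim/clsW=> x; elim/clsW=> y; elim/clsW=> z.
by rewrite !(qmulE, qaddE); apply/clsP; apply: qeq_mulDr.
Qed.

(* Nontriviality: X_i acts on functions Z^n -> F by a twisted shift.          *)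
Let V := 'cV[int]_n -> F.
Let e (i : 'I_n) : 'cV[int]_n := delta_mx i 0.

Let wt (i : 'I_n) (a : 'cV[int]_n) : F :=
  \prod_(k < n | (k < i)%N) q i k ^ a k 0.

Let wt_neq0 i a : wt i a != 0.
Proof.
by case: hq => q0 _ _; apply/prodf_neq0 => k _; rewrite expfz_neq0.
Qed.

Let wt_shift i j a :
  wt i (a - e j) = (if (j < i)%N then (q i j)^-1 else 1) * wt i a.
Proof.
case: hq => q0 _ _; rewrite /wt; case: ifP => [ji|ji].
  rewrite (bigD1 j) //= [in RHS](bigD1 j) //= mulrA; congr (_ * _).
    by rewrite !mxE !eqxx /= addrC expfzDr // -exprz_inv expr1z.
  apply: eq_bigr => k /andP[_ kj]; congr (_ ^ _).
  by rewrite !mxE (negPf kj) subr0.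
rewrite mul1r; apply: eq_bigr => k ki; congr (_ ^ _); rewrite !mxE.
have /negPf-> : k != j by apply: contraTneq ki => ->; rewrite ji.
by rewrite subr0.
Qed.

Fixpoint qact (x : E) : V -> V :=
  match x with
  | QX i => fun f a => wt i a * f (a - e i)
  | QXV i => fun f a => (wt i (a + e i))^-1 * f (a + e i)
  | QC c => fun f a => c * f a
  | QAdd x y => fun f a => qact x f a + qact y f a
  | QMul x y => fun f => qact x (qact y f)
  end.

Fact qact_linear x c (f g : V) :
  qact x (fun a => c * f a + g a) = fun a => c * qact x f a + qact x g a.
Proof.
elim: x f g => [i|i|b|x IHx y IHy|x IHx y IHy] f g; apply/funext => a /=.
- by rewrite mulrDr mulrCA.
- by rewrite mulrDr mulrCA.
- by rewrite mulrDr mulrCA.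
- by rewrite IHx IHy mulrDr addrACA.
- by rewrite IHy IHx.
Qed.

Fact qact_sound x y : qeq x y -> qact x = qact y.
Proof.
elim=> {x y} //=.
- by move=> x y z _ -> _ ->.
- by move=> x x' y y' _ -> _ ->.
- by move=> x x' y y' _ -> _ ->.
- by move=> x y z; apply/funext=> f; apply/funext=> a; rewrite addrA.
- by move=> x y; apply/funext=> f; apply/funext=> a; rewrite addrC.
- by move=> x; apply/funext=> f; apply/funext=> a; rewrite mul0r add0r.
- by move=> x; apply/funext=> f; apply/funext=> a; rewrite mulN1r addNr mul0r.
- by move=> x; apply/funext=> f; apply/funext=> a; rewrite mul1r.
- move=> x y z; apply/funext=> f; apply/funext=> a.
  have := qact_linear x 1 (qact y f) (qact z f).
  move=> /(congr1 (fun h : V => h a)); rewrite mul1r => <-.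
  by congr (qact x _ a); apply/funext=> b; rewrite mul1r.
- by move=> a b; apply/funext=> f; apply/funext=> c; rewrite mulrDl.
- by move=> a b; apply/funext=> f; apply/funext=> c; rewrite mulrA.
- move=> c x; apply/funext=> f; apply/funext=> a.
  have := qact_linear x c f (fun=> 0).
  have := qact_linear x (-1) f f.
  have -> : (fun a => -1 * f a + f a) = (fun=> 0).
    by apply/funext=> b; rewrite mulN1r addNr.
  have -> : (fun a => c * f a + 0) = (fun a => c * f a).
    by apply/funext=> b; rewrite addr0.
  by move=> -> ->; rewrite mulN1r addNr addr0.
- move=> i; apply/funext=> f; apply/funext=> a.
  by rewrite subrK mulrA mulfV ?mul1r.
- move=> i; apply/funext=> f; apply/funext=> a.
  by rewrite addrK mulrA mulVf ?mul1r.
- move=> i j; apply/funext=> f; apply/funext=> a; case: hq => q0 q1 qV.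
  rewrite !wt_shift addrAC !mulrA; congr (_ * f _).
  case: (ltngtP i j) => [ij|ji|/val_inj->].
  + by rewrite (qV i j) invrK mulr1 [wt i a * _]mulrC mulrAC.
  + by rewrite mulr1 [q i j * _]mulrC mulfK // mulrC.
  + by rewrite q1 mul1r.
Qed.

Fact qscalar_inj : injective qscalar.
Proof.
move=> b c /clsP /qact_sound /(congr1 (fun f : V -> V => f (fun=> 1) 0)) /=.
by rewrite !mulr1.
Qed.

Fact qone_neq0 : qscalar 1 != 0.
Proof. by apply/eqP => /qscalar_inj /eqP; rewrite oner_eq0. Qed.

HB.instance Definition _ :=
  GRing.Zmodule_isNzRing.Build T qmulA qmul1 qmulr1 qmulDl qmulDr qone_neq0.

Let qscale (c : F) (x : T) : T := qmul (qscalar c) x.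

Fact qscaleA a b x : qscale a (qscale b x) = qscale (a * b) x.
Proof.
rewrite /qscale qmulA; congr qmul.
by rewrite qmulE; apply/clsP/qeq_sym/qeq_CM.
Qed.

Fact qscale1 : left_id 1 qscale.
Proof. exact: qmul1. Qed.

Fact qscaleDr : right_distributive qscale +%R.
Proof. by move=> a x y; apply: qmulDr. Qed.

Fact qscaleDl x : {morph qscale^~ x : a b / a + b}.
Proof.
move=> a b; rewrite /qscale -[RHS]qmulDl; congr qmul.
by rewrite [RHS]qaddE; apply/clsP/qeq_CD.
Qed.

HB.instance Definition _ :=
  GRing.Zmodule_isLmodule.Build F T qscaleA qscale1 qscaleDr qscaleDl.

Fact qscaleAl (a : F) (x y : T) : a *: (x * y) = a *: x * y.
Proof. exact: qmulA. Qed.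

HB.instance Definition _ := GRing.Lmodule_isLalgebra.Build F T qscaleAl.

Fact qscaleAr (a : F) (x y : T) : a *: (x * y) = x * (a *: y).
Proof.
rewrite qscaleAl [LHS](congr1 (qmul^~ y) (qscalarC a x)).
exact: (esym (qmulA _ _ _)).
Qed.

HB.instance Definition _ := GRing.Lalgebra_isAlgebra.Build F T qscaleAr.

Let qinvset (x : T) : set T := [set y | y * x = 1 /\ x * y = 1].
Let qunit (x : T) : bool := `[< exists y, qinvset x y >].
Let qinv (x : T) : T := xget x (qinvset x).

Let qinvP x : qunit x -> qinvset x (qinv x).
Proof. by move=> /asboolP[y xy]; apply: (xgetPex _ (ex_intro _ y xy)). Qed.

Fact qmulVr : {in qunit, left_inverse 1 qinv *%R}.
Proof. by move=> x /qinvP[]. Qed.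

Fact qdivrr : {in qunit, right_inverse 1 qinv *%R}.
Proof. by move=> x /qinvP[]. Qed.

Fact qunitP x y : y * x = 1 /\ x * y = 1 -> qunit x.
Proof. by move=> xy; apply/asboolP; exists y. Qed.

Fact qinv_out : {in [predC qunit], qinv =1 id}.
Proof.
move=> x /negP xN; apply: xgetPN => y xy; apply: xN.
by apply/asboolP; exists y.
Qed.

HB.instance Definition _ :=
  GRing.NzRing_hasMulInverse.Build T qmulVr qdivrr qunitP qinv_out.

Definition qX (i : 'I_n) : T := \pi_T (QX i).

Let qXV (i : 'I_n) : T := cls (QXV i).

Let qXVX i : qXV i * qX i = 1 /\ qX i * qXV i = 1.
Proof.
by split; apply: etrans (qmulE _ _) _; apply/clsP; [apply: qeq_VX|apply: qeq_XV].
Qed.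

Lemma qX_unit i : qX i \is a GRing.unit.
Proof. by apply/unitrP; exists (qXV i); apply: qXVX. Qed.

Lemma qX_comm i j : qX i * qX j = q i j *: (qX j * qX i).
Proof.
apply: etrans (qmulE _ _) _; apply: esym; rewrite -[qX j * _]/(qmul _ _).
by rewrite qmulE [LHS]qmulE; apply/clsP/qeq_sym/qeq_XX.
Qed.

(* Z^n consists of column vectors; the product is taken in the order of the   *)
(* indices, m_i being an integer exponent.                                    *)
Definition qmonom (m : 'cV[int]_n) : T := \prod_(i < n) qX i ^ m i 0.

Lemma qmonom_unit m : qmonom m \is a GRing.unit.
Proof. by apply: rpred_prod => i _; apply: rpredXz; apply: qX_unit. Qed.

Definition qcommutator (m m' : 'cV[int]_n) : T :=
  qmonom m * qmonom m' * (qmonom m)^-1 * (qmonom m')^-1.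

(* The commutator is a scalar c%:A; lambda(m, m') is the corresponding c in F *)
(* (see qlambdaP, which also shows that it is uniquely determined).           *)
Definition qlambda (m m' : 'cV[int]_n) : F :=
  xget 0 [set c : F | c%:A = qcommutator m m'].

Let qcomm (x y : T) := exists2 c : F, c != 0 & x * y = c *: (y * x).

Let qcomm_sym x y : qcomm x y -> qcomm y x.
Proof.
move=> [c c0 xy]; exists c^-1; rewrite ?invr_neq0 //.
by rewrite xy scalerA mulVf // scale1r.
Qed.

Let qcomm1 x : qcomm x 1.
Proof. by exists 1; rewrite ?oner_neq0 // mulr1 mul1r scale1r. Qed.

Let qcommM x y z : qcomm x y -> qcomm x z -> qcomm x (y * z).
Proof.
move=> [c c0 xy] [d d0 xz]; exists (c * d); first by rewrite mulf_neq0.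
by rewrite mulrA xy -scalerAl -[y * x * z]mulrA xz -scalerAr scalerA mulrA.
Qed.

Let qcommV x y : y \is a GRing.unit -> qcomm x y -> qcomm x y^-1.
Proof.
move=> uy /qcomm_sym[c c0 yx]; exists c => //; apply: (mulrI uy).
by rewrite -scalerAr [in RHS]mulrA divrr // mul1r mulrA yx -scalerAl mulrK.
Qed.

Let qcommX x y (k : nat) : qcomm x y -> qcomm x (y ^+ k).
Proof.
by move=> xy; elim: k => [|k IHk]; rewrite ?expr0 ?exprS; [exact: qcomm1|exact: qcommM].
Qed.

Let qcommZ x y (k : int) :
  y \is a GRing.unit -> qcomm x y -> qcomm x (y ^ k).
Proof.
move=> uy xy; case: k => k; first exact: qcommX.
by rewrite NegzE -exprz_inv; apply: qcommX; apply: qcommV.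
Qed.

Let qcomm_monom x m : (forall i, qcomm x (qX i)) -> qcomm x (qmonom m).
Proof.
move=> xX; rewrite /qmonom; elim/big_rec: _ => [|i y _ xy]; first exact: qcomm1.
by apply: qcommM => //; apply: qcommZ => //; apply: qX_unit.
Qed.

Lemma qscalarA_inj : injective (fun c : F => c%:A : T).
Proof. by move=> b c /= bc; apply: qscalar_inj; rewrite -[LHS]qmulr1 -[RHS]qmulr1. Qed.

Lemma qlambdaP m m' c : c%:A = qcommutator m m' <-> c = qlambda m m'.
Proof.
have ex : exists c : F, c%:A = qcommutator m m'.
  have [|d _ xy] := @qcomm_monom (qmonom m) m'.
    move=> i; apply/qcomm_sym/qcomm_monom => j; exists (q i j).
      by case: hq.
    exact: qX_comm.
  exists d; rewrite /qcommutator xy -!scalerAl; congr (_ *: _).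
  by rewrite mulrK ?divrr // qmonom_unit.
have lP : (qlambda m m')%:A = qcommutator m m'.
  by case: ex => d hd; rewrite /qlambda; case: xgetP => [y _ //|/(_ d)].
by split=> [|->//]; rewrite -lP => /qscalarA_inj.
Qed.

Lemma qmonom_delta i : qmonom (delta_mx i 0) = qX i.
Proof.
rewrite /qmonom (eq_bigr (fun k => if k == i then qX k else 1)); last first.
  by move=> k _; rewrite mxE eqxx andbT; case: eqP.
by rewrite -big_mkcond big_pred1_eq.
Qed.

Lemma qlambda_delta i j : qlambda (delta_mx i 0) (delta_mx j 0) = q i j.
Proof.
apply/esym/qlambdaP; rewrite /qcommutator !qmonom_delta qX_comm -!scalerAl.
by rewrite mulrK ?divrr // qX_unit.
Qed.

Definition Aut_lambda : set 'M[int]_n :=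
  [set sigma | sigma \in unitmx /\
     forall m m', qlambda (sigma *m m) (sigma *m m') = qlambda m m'].

End QuantumTorus.

Inductive Lambda (F : fieldType) (n : nat) (q : 'M[F]_n) : set F :=
| Lambda_gen i j : Lambda q (q i j)
| Lambda1 : Lambda q 1
| LambdaM x y : Lambda q x -> Lambda q y -> Lambda q (x * y)
| LambdaV x : Lambda q x -> Lambda q x^-1.

Definition mul_torsion_free (F : fieldType) (G : set F) : Prop :=
  forall x (k : nat), G x -> (0 < k)%N -> x ^+ k = 1 -> x = 1.

Definition mul_basis (F : fieldType) (G : set F) (l : nat) (p : 'I_l -> F) :
    Prop :=
  (forall s, G (p s)) /\
  (forall x, G x -> exists! a : {ffun 'I_l -> int}, x = \prod_s p s ^ a s).

(* allpairs varies the second component fastest: lexicographic order.         *)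
Definition ipairs (n : nat) : seq ('I_n * 'I_n) :=
  [seq ij : 'I_n * 'I_n <- [seq (i, j) | i <- enum 'I_n, j <- enum 'I_n] |
    (ij.1 < ij.2)%N].

Fact size_ipairs n : size (ipairs n) == 'C(n, 2).
Proof.
rewrite size_filter -sum1_count big_mkcond big_allpairs_dep /=.
rewrite !big_enum /= -bin2_sum big_mkord; apply/eqP.
under eq_bigr do rewrite big_enum /=.
rewrite exchange_big /=; apply: eq_bigr => j _.
by rewrite -big_mkcond /= (big_ord_narrow (ltnW (ltn_ord j))) sum1_card card_ord.
Qed.

Lemma mem_ipairs n (i j : 'I_n) : ((i, j) \in ipairs n) = (i < j)%N.
Proof.
rewrite mem_filter /= -[RHS]andbT; congr (_ && _).
by apply/allpairsP; exists (i, j); rewrite !mem_enum.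
Qed.

Definition wedge_index (n : nat) : 'C(n, 2).-tuple ('I_n * 'I_n) :=
  Tuple (size_ipairs n).

Definition minor2 (n : nat) (A : 'M[int]_n) (r c : 'I_n * 'I_n) : int :=
  \det (\matrix_(a < 2, b < 2)
          A (if a == 0 then r.1 else r.2) (if b == 0 then c.1 else c.2)).

Definition wedge2 (n : nat) (A : 'M[int]_n) : 'M[int]_('C(n, 2)) :=
  \matrix_(r, c) minor2 A (tnth (wedge_index n) r) (tnth (wedge_index n) c).

Definition Stab_wedge2 (n l : nat) (M : 'M[int]_('C(n, 2), l)) :
    set 'M[int]_n :=
  [set A | A \in unitmx /\ wedge2 A *m M = M].

Definition exponent_matrix (F : fieldType) (n : nat) (q : 'M[F]_n)
    (hq : mul_antisym q) (l : nat) (p : 'I_l -> F)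
    (M : 'M[int]_('C(n, 2), l)) : Prop :=
  forall r : 'I_('C(n, 2)),
    let: (i, j) := tnth (wedge_index n) r in
    qlambda hq (delta_mx i 0) (delta_mx j 0) = \prod_s p s ^ M r s.

(* Main.v *)
Require Import Defs.
From mathcomp Require Import all_boot all_order all_algebra.
From mathcomp Require Import boolp classical_sets.

Set Implicit Arguments.
Unset Strict Implicit.
Unset Printing Implicit Defensive.

Import GRing.Theory.
Local Open Scope classical_set_scope.
Local Open Scope ring_scope.

(** A monomial in the generators is moved past another one by collecting a
    scalar for each pair of letters, so the commutator pairing is
    lambda(m, m') = prod_ij q_ij ^ (m_i m'_j) ([qlambdaE]).  From this formula
    everything follows from bilinearity and antisymmetry.

    Antisymmetry pairs the factor (i, j) with the factor (j, i), and lambda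
    becomes prod_{i<j} q_ij ^ (m_i m'_j - m_j m'_i) ([bichar_wedge]): it depends
    on m and m' only through m /\ m'.  When m and m' are two columns of A^T, that
    is, two rows of A, the exponents are the 2 x 2 minors of A on these rows;
    writing each q_ij in the basis p turns the sum of exponents into a matrix
    product, so that lambda(A^T e_i, A^T e_j) = prod_s p_s ^ (wedge2 A *m M)_{ij,s}
    ([qlambda_wedge2]).

    Bilinearity makes the invariance of lambda under A^T a condition on the
    basis vectors, and antisymmetry reduces it further to the pairs i < j
    ([qlambda_preservedP]).  For such a pair, both sides of the condition are
    products of powers of the p_s, with exponents the rows (i, j) of
    wedge2 A *m M and of M; as exponents with respect to a basis are unique, the
    condition says that these rows are equal. *)

(** * Integer powers *)

Lemma prodrXz (F : fieldType) (I : Type) (r : seq I) (f : I -> F) (k : int) :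
  \prod_(i <- r) f i ^ k = (\prod_(i <- r) f i) ^ k.
Proof.
by apply/esym/(big_morph (fun x => x ^ k)) => [x y|]; rewrite ?expfzMl ?exp1rz.
Qed.

Lemma exprz_sum (F : fieldType) (x : F) (I : Type) (r : seq I) (k : I -> int) :
  x != 0 -> x ^ (\sum_(i <- r) k i) = \prod_(i <- r) x ^ k i.
Proof. by move=> x0; apply: big_morph => // a b; rewrite expfzDr. Qed.

(** * Commutation up to a scalar *)

Definition skew_comm (F : fieldType) (A : unitAlgType F) (c : F) (x y : A) :
    Prop :=
  x * y = c *: (y * x).

Lemma skew_comm1 (F : fieldType) (A : unitAlgType F) (x : A) :
  skew_comm 1 x 1.
Proof. by rewrite /skew_comm mulr1 mul1r scale1r. Qed.

Lemma skew_commM (F : fieldType) (A : unitAlgType F) (c d : F) (x y z : A) :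
  skew_comm c x y -> skew_comm d x z ->
  skew_comm (c * d) x (y * z).
Proof.
move=> xy xz; rewrite /skew_comm mulrA xy -scalerAl -[y * x * z]mulrA xz.
by rewrite -scalerAr scalerA mulrA.
Qed.

Lemma skew_comm_sym (F : fieldType) (A : unitAlgType F) (c : F) (x y : A) :
  c != 0 -> skew_comm c x y -> skew_comm c^-1 y x.
Proof. by move=> c0 xy; rewrite /skew_comm xy scalerA mulVf ?scale1r. Qed.

Lemma skew_commV (F : fieldType) (A : unitAlgType F) (c : F) (x y : A) :
  c != 0 -> y \is a GRing.unit -> skew_comm c x y ->
  skew_comm c^-1 x y^-1.
Proof.
move=> c0 uy /(skew_comm_sym c0) yx; apply: (mulrI uy).
by rewrite -scalerAr [in RHS]mulrA divrr // mul1r mulrA yx -scalerAl mulrK.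
Qed.

Lemma skew_commXz (F : fieldType) (A : unitAlgType F) (c : F) (x y : A)
    (k : int) :
  c != 0 -> y \is a GRing.unit -> skew_comm c x y ->
  skew_comm (c ^ k) x (y ^ k).
Proof.
(* Nonnegative exponents go by induction; negative ones are powers of y^-1. *)
have natX (d : F) (z : A) (m : nat) :
    skew_comm d x z -> skew_comm (d ^+ m) x (z ^+ m).
  move=> xz; elim: m => [|m IHm]; first exact: skew_comm1.
  by rewrite !exprS; apply: skew_commM.
move=> c0 uy xy; case: k => k; first exact: natX.
by rewrite NegzE -!exprz_inv; apply: natX; apply: skew_commV.
Qed.

Lemma skew_comm_prodXz (F : fieldType) (A : unitAlgType F) (I : Type)
    (r : seq I) (c : I -> F) (x : A) (y : I -> A) (k : I -> int) :
  (forall i, c i != 0) -> (forall i, y i \is a GRing.unit) ->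
  (forall i, skew_comm (c i) x (y i)) ->
  skew_comm (\prod_(i <- r) c i ^ k i) x (\prod_(i <- r) y i ^ k i).
Proof.
move=> c0 uy xy; elim: r => [|i r IHr]; first by rewrite !big_nil; apply: skew_comm1.
by rewrite !big_cons; apply: skew_commM => //; apply: skew_commXz.
Qed.

(** * The commutator pairing as a bicharacter *)

Definition bichar (F : fieldType) (n : nat) (q : 'M[F]_n) (m m' : 'cV[int]_n) : F :=
  \prod_i \prod_j q i j ^ (m i 0 * m' j 0).

(** Two passes: one letter X_i goes through X^m', then the monomial X^m' goes
    through the product of the powers of the X_i. *)
Lemma qlambdaE (F : fieldType) (n : nat) (q : 'M[F]_n) (hq : mul_antisym q)
    (m m' : 'cV[int]_n) :
  qlambda hq m m' = bichar q m m'.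
Proof.
have q0 i j : q i j != 0 by case: hq.
pose c i := \prod_j q i j ^ m' j 0.
have c0 i : c i != 0 by apply/prodf_neq0 => j _; rewrite expfz_neq0.
have XM i : skew_comm (c i) (qX hq i) (qmonom hq m').
  by apply: skew_comm_prodXz => // j; [exact: qX_unit|exact: qX_comm].
have MM : skew_comm (\prod_i (c i)^-1 ^ m i 0)
    (qmonom hq m') (qmonom hq m).
  apply: skew_comm_prodXz => i; first by rewrite invr_neq0.
  - exact: qX_unit.
  - exact: skew_comm_sym.
have -> : bichar q m m' = (\prod_i (c i)^-1 ^ m i 0)^-1.
  rewrite -prodfV; apply: eq_bigr => i _; rewrite expfV invrK -prodrXz.
  by apply: eq_bigr => j _; rewrite exprz_exp mulrC.
apply/esym/qlambdaP; rewrite /qcommutator (skew_comm_sym _ MM).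
  by rewrite -!scalerAl mulrK ?divrr // qmonom_unit.
by apply/prodf_neq0 => i _; rewrite expfz_neq0 ?invr_neq0.
Qed.

(** This is bilinearity in the form that reduces a statement on all m and m' to
    the standard basis vectors: the right-hand side is again a bicharacter, so
    two such functions agree as soon as their matrices do. *)
Lemma bichar_mulmx (F : fieldType) (n : nat) (q : 'M[F]_n)
    (q0 : forall i j, q i j != 0) (sigma : 'M[int]_n) (m m' : 'cV[int]_n) :
  bichar q (sigma *m m) (sigma *m m') =
  bichar (\matrix_(i, j) bichar q (col i sigma) (col j sigma)) m m'.
Proof.
transitivity (\prod_k \prod_l \prod_i \prod_j
    q k l ^ (sigma k i * sigma l j * (m i 0 * m' j 0))).
  apply: eq_bigr => k _; apply: eq_bigr => l _; rewrite !mxE mulr_suml exprz_sum //.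
  apply: eq_bigr => i _; rewrite mulr_sumr exprz_sum //.
  by apply: eq_bigr => j _; rewrite mulrACA.
under eq_bigr => k _ do rewrite exchange_big.
rewrite exchange_big; apply: eq_bigr => i _.
under eq_bigr => k _ do rewrite exchange_big.
rewrite exchange_big; apply: eq_bigr => j _.
rewrite mxE -prodrXz; apply: eq_bigr => k _; rewrite -prodrXz.
by apply: eq_bigr => l _; rewrite exprz_exp !mxE.
Qed.

(** * Antisymmetry and pairs of indices *)

Lemma wedge_index_onto (n : nat) (i j : 'I_n) :
  (i < j)%N -> exists r, tnth (wedge_index n) r = (i, j).
Proof.
rewrite -mem_ipairs => ij; have /tnthP[r ->] : (i, j) \in wedge_index n by [].
by exists r.
Qed.

(** The product over all ordered pairs folds along the diagonal, where the
    factors are trivial: the factors (i, j) and (j, i) are collected at i < j. *)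
Lemma prod_wedge_index (R : comPzSemiRingType) (n : nat) (f : 'I_n -> 'I_n -> R) :
  (forall i, f i i = 1) ->
  \prod_i \prod_j f i j =
  \prod_r (f (tnth (wedge_index n) r).1 (tnth (wedge_index n) r).2 *
           f (tnth (wedge_index n) r).2 (tnth (wedge_index n) r).1).
Proof.
move=> f1; rewrite -(big_tuple _ _ (wedge_index n) xpredT
  (fun ij => f ij.1 ij.2 * f ij.2 ij.1)) /=.
rewrite /ipairs big_filter [RHS]big_mkcond big_allpairs_dep big_enum /=.
under [in RHS]eq_bigr => i _ do rewrite big_enum /=.
pose up (i j : 'I_n) := if (i < j)%N then f i j else 1.
pose dn (i j : 'I_n) := if (j < i)%N then f i j else 1.
have fE i j : f i j = up i j * dn i j.
  by rewrite /up /dn; case: ltngtP => [||/val_inj->]; rewrite ?mulr1 ?mul1r ?f1.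
under eq_bigr => i _ do (under eq_bigr => j _ do rewrite fE; rewrite big_split).
rewrite big_split /= [X in _ * X]exchange_big -big_split; apply: eq_bigr => i _.
rewrite -big_split; apply: eq_bigr => j _; rewrite /up /dn.
by case: ifP => _ /=; rewrite ?mulr1.
Qed.

Lemma bichar_wedge (F : fieldType) (n : nat) (q : 'M[F]_n)
    (hq : mul_antisym q) (m m' : 'cV[int]_n) :
  bichar q m m' =
  \prod_r (let: (i, j) := tnth (wedge_index n) r in
           q i j ^ (m i 0 * m' j 0 - m j 0 * m' i 0)).
Proof.
case: hq => q0 q1 qV; rewrite /bichar prod_wedge_index; last first.
  by move=> i; rewrite q1 exp1rz.
apply: eq_bigr => r _; case: (tnth _ r) => i j /=.
by rewrite (qV i j) exprz_inv expfzDr.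
Qed.

(** The pullback of the pairing by a matrix is alternating as well, so comparing
    it with q only requires the entries above the diagonal.  The diagonal
    entries are 1 because v /\ v = 0 in the formula of [bichar_wedge]. *)
Lemma mul_antisym_bichar (F : fieldType) (n : nat) (q : 'M[F]_n)
    (hq : mul_antisym q) (k : nat) (v : 'I_k -> 'cV[int]_n) :
  mul_antisym (\matrix_(i, j) bichar q (v i) (v j)).
Proof.
have [q0 _ qV] := hq; split=> [i j|i|i j]; rewrite !mxE.
- by apply/prodf_neq0 => a _; apply/prodf_neq0 => b _; rewrite expfz_neq0.
- rewrite bichar_wedge // big1 // => r _; case: (tnth _ r) => a b.
  by rewrite [_ * v i a 0]mulrC subrr.
- rewrite /bichar exchange_big -prodfV; apply: eq_bigr => a _.
  rewrite -prodfV; apply: eq_bigr => b _.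
  by rewrite (qV a b) expfV mulrC.
Qed.

Lemma mul_antisym_eq (F : fieldType) (n : nat) (q q' : 'M[F]_n) :
  mul_antisym q -> mul_antisym q' ->
  (forall r, let: (i, j) := tnth (wedge_index n) r in q i j = q' i j) ->
  q = q'.
Proof.
move=> [_ q1 qV] [_ q'1 q'V] qq'.
have lt_eq (i j : 'I_n) : (i < j)%N -> q i j = q' i j.
  by move=> /wedge_index_onto[r rE]; have := qq' r; rewrite rE.
apply/matrixP => i j; case: (ltngtP i j) => [/lt_eq//|ji|/val_inj->].
  by rewrite qV q'V lt_eq.
by rewrite q1 q'1.
Qed.

Lemma qlambda_preservedP (F : fieldType) (n : nat) (q : 'M[F]_n)
    (hq : mul_antisym q) (sigma : 'M[int]_n) :
  (forall m m', qlambda hq (sigma *m m) (sigma *m m') = qlambda hq m m') <->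
  (forall r, let: (i, j) := tnth (wedge_index n) r in
     qlambda hq (col i sigma) (col j sigma) = q i j).
Proof.
have [q0 _ _] := hq; split=> [inv r|inv m m'].
  by case: (tnth _ r) => i j; rewrite !colE inv qlambda_delta.
rewrite !qlambdaE bichar_mulmx //; congr (bichar _ m m').
apply: mul_antisym_eq => //; first exact: mul_antisym_bichar.
by move=> r; have := inv r; case: (tnth _ r) => i j; rewrite mxE qlambdaE.
Qed.

(** * The bivector representation *)

Lemma minor2E (n : nat) (A : 'M[int]_n) (r c : 'I_n * 'I_n) :
  minor2 A r c = A r.1 c.1 * A r.2 c.2 - A r.1 c.2 * A r.2 c.1.
Proof.
rewrite /minor2 (expand_det_row _ 0) !big_ord_recl big_ord0 addr0.
rewrite /cofactor !det_mx11 !mxE /= expr0 expr1 mul1r.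
by rewrite !mulN1r mulrN.
Qed.

(** The rows of A, as columns of A^T, have as wedge product the row of minors of
    A; this is where the transposition of the theorem comes from. *)
Lemma qlambda_wedge2 (F : fieldType) (n : nat) (q : 'M[F]_n)
    (hq : mul_antisym q) (l : nat) (p : 'I_l -> F)
    (p0 : forall s, p s != 0) (M : 'M[int]_('C(n, 2), l))
    (hM : exponent_matrix hq p M) (A : 'M[int]_n) (r : 'I_('C(n, 2))) :
  (let: (i, j) := tnth (wedge_index n) r in
   qlambda hq (col i A^T) (col j A^T)) = \prod_s p s ^ (wedge2 A *m M) r s.
Proof.
transitivity (\prod_c \prod_s p s ^ (wedge2 A r c * M c s)); last first.
  rewrite exchange_big; apply: eq_bigr => s _.
  by rewrite mxE exprz_sum.
case rE: (tnth _ r) => [i j]; rewrite qlambdaE bichar_wedge //.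
apply: eq_bigr => c _; rewrite !mxE minor2E rE.
have := hM c; case: (tnth _ c) => k k'; rewrite qlambda_delta => ->.
rewrite -prodrXz; apply: eq_bigr => s _.
by rewrite !mxE exprz_exp mulrC.
Qed.

(** * Exponents with respect to a basis *)

Lemma Lambda_neq0 (F : fieldType) (n : nat) (q : 'M[F]_n)
    (q0 : forall i j, q i j != 0) (x : F) :
  Lambda q x -> x != 0.
Proof.
elim=> {x} [i j||x y _ x0 _ y0|x _ x0] //; first exact: oner_neq0.
  by rewrite mulf_neq0.
by rewrite invr_neq0.
Qed.

Lemma mul_basis_inj (F : fieldType) (G : set F) (l : nat) (p : 'I_l -> F)
    (hp : mul_basis G p) (a b : 'I_l -> int) :
  G (\prod_s p s ^ b s) -> \prod_s p s ^ a s = \prod_s p s ^ b s -> a =1 b.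
Proof.
move=> /(proj2 hp)[c [_ uniq_c]] ab s.
have ca : c = [ffun s => a s].
  by apply: uniq_c; rewrite -ab; apply: eq_bigr => t _; rewrite ffunE.
have cb : c = [ffun s => b s].
  by apply: uniq_c; apply: eq_bigr => t _; rewrite ffunE.
by move: cb; rewrite ca => /ffunP/(_ s); rewrite !ffunE.
Qed.

Theorem theoremA (F : fieldType) (n : nat) (hn : (2 <= n)%N)
  (q : 'M[F]_n) (hq : mul_antisym q)
  (tf : mul_torsion_free (Lambda q))
  (l : nat) (p : 'I_l -> F) (hp : mul_basis (Lambda q) p)
  (M : 'M[int]_('C(n, 2), l)) (hM : exponent_matrix hq p M) :
  Aut_lambda hq = [set A^T | A in Stab_wedge2 M].
Proof.
have [q0 _ _] := hq.
have p0 s : p s != 0 by apply: (Lambda_neq0 q0); case: hp.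
have stabP (A : 'M[int]_n) : wedge2 A *m M = M <->
    (forall m m', qlambda hq (A^T *m m) (A^T *m m') = qlambda hq m m').
  rewrite qlambda_preservedP; split=> [stab r|inv].
    have := qlambda_wedge2 p0 hM A r; have := hM r.
    by case: (tnth _ r) => i j; rewrite qlambda_delta stab => -> ->.
  (* Uniqueness of exponents applies since q i j lies in Lambda. *)
  apply/matrixP => r; apply: (mul_basis_inj hp).
    have := hM r; case: (tnth _ r) => i j; rewrite qlambda_delta => <-.
    exact: Lambda_gen.
  have := qlambda_wedge2 p0 hM A r; have := hM r; have := inv r.
  by case: (tnth _ r) => i j; rewrite qlambda_delta => -> -> ->.
apply/seteqP; split=> [sigma [usigma inv]|_ [A [uA stab] <-]].
  exists sigma^T; last by rewrite trmxK.
  by split; [rewrite unitmx_tr|apply/stabP; rewrite trmxK].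
by split; [rewrite unitmx_tr|apply/stabP].
Qed.
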